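(* Let $p$ be an odd prime and let $K$, $L$, $M$, $N$ be integers with $0\le K<K+M<p$ and $0\le L<L+N<p$. Let $\ell\ge 1$ be an integer, and suppose $N^2\ge M\ge N^{1/2}$. Let $F_\ell(K,M;L,N)$ be the number of tuples of integers $(m_1,\ldots,m_{2\ell},n_1,\ldots,n_{2\ell})$ with $K+1\le m_1,\ldots,m_{2\ell}\le K+M$ and $L+1\le n_1,\ldots,n_{2\ell}\le L+N$ satisfying $$\sum_{i=1}^{\ell} n_i!\,m_i! \equiv \sum_{i=\ell+1}^{2\ell} n_i!\,m_i! \pmod p.$$ Then $$F_\ell(K,M;L,N)\ll M^{2\ell-1+1/(2\ell)}\, N^{2\ell-1/(2(\ell+1))}.$$
   Context: The notation $U\ll V$ means $|U|\le cV$ for some constant $c>0$; here $c$ may depend on $\ell$ only. *)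

(* Defs.v *)
From mathcomp Require Import all_boot all_order all_algebra.

Set Implicit Arguments.
Unset Strict Implicit.
Unset Printing Implicit Defensive.

(* The index i of the usual 1-based numbering is the ordinal i - 1, so the     *)
(* first l indices are those with i < l.  The codomains 'I_(K + M).+1 and      *)
(* 'I_(L + N).+1 already enforce the upper bounds m_i <= K + M, n_i <= L + N.  *)
Definition F_count (p l K M L N : nat) : nat :=
  #|[set mn : {ffun 'I_(2 * l) -> 'I_(K + M).+1} *
              {ffun 'I_(2 * l) -> 'I_(L + N).+1} |
      [&& [forall i, K + 1 <= mn.1 i],
          [forall i, L + 1 <= mn.2 i]
        & \sum_(i < 2 * l | i < l) (mn.2 i)`! * (mn.1 i)`!
            == \sum_(i < 2 * l | l <= i) (mn.2 i)`! * (mn.1 i)`! %[mod p]]]|.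

(* Main.v *)
Require Import Defs.
From mathcomp Require Import all_boot all_order all_algebra.
From mathcomp Require Import reals exp.
From mathcomp Require Import all_field ring lra zify.

Set Implicit Arguments.
Unset Strict Implicit.
Unset Printing Implicit Defensive.

(* Cut the range of the m_i into blocks of length R and write the count as a   *)
(* 2l-th moment of exponential sums; Hölder's inequality reduces it to the     *)
(* solutions whose m_i all lie in one block. Dividing by the factorial of the  *)
(* least m_i turns the congruence into a polynomial equation of degree < R in  *)
(* that variable, with at most R - 1 roots, unless for every value m the       *)
(* signed sum of the n_i! over the indices with m_i = m vanishes mod p. In the *)
(* latter case no value m is taken only once, since n! is prime to p; if s     *)
(* values occur, there are O(R^s) choices for the m_i in a block and, by       *)
(* Fourier inversion, at most N^(2l-2s) J_1^s choices for the n_i, where J_k   *)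
(* counts solutions of n_1! + ... + n_k! = n_(k+1)! + ... + n_(2k)!; for s = 1 *)
(* there are J_l. The same argument without the n_i, with R about N^(1/(l+1)), *)
(* gives J_l << N^(2l-1+1/(l+1)), and R about M^(1/(2l)) N^(-1/(2(l+1))) then  *)
(* gives the theorem; M <= N^2 is what makes the cases s >= 2 negligible.      *)

Import Order.TTheory GRing.Theory Num.Theory.
Local Open Scope ring_scope.

(** The block length R balances two terms. [block_energy] bounds the count by a constant times
    M^(2l-1) N^(2l) R, from nonzero polynomials ([local_energy]), plus (M/R)^(2l) D, where D counts
    the degenerate configurations in one block ([vanishing_pairs_count]). If D << R Z, the terms
    agree when M Z = R^(2l) N^(2l); [energy_of_vanishing] records this trade-off. It is used twice:
    without the n_i, with Z = R^(l-1), it bounds J_l ([factorial_energy]); then J_l, together with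
    J_1 << N^(3/2) for s >= 2, gives Z = N^(2l-1+1/(l+1)) and the theorem ([product_energy]). *)

(** * Additive characters, moments and Hölder's inequality *)

Lemma additive_character_exists (p : nat) : prime p ->
  exists chi : 'F_p -> algC,
    [/\ chi 0 = 1, {morph chi : x y / x + y >-> x * y}, forall x, chi (- x) = (chi x)^*
      & forall x, \sum_a chi (a * x) = if x == 0 then p%:R else 0].
Proof.
move=> p_pr; have [z zP] := C_prim_root_exists (prime_gt0 p_pr).
have zp := prim_expr_order zP.
have Ep : (Zp_trunc (pdiv p)).+2 = p by exact: Fp_cast.
have zmod n : z ^+ (n %% (Zp_trunc (pdiv p)).+2) = z ^+ n.
  by rewrite Ep prim_expr_mod.
pose chi (x : 'F_p) := z ^+ x.
have chiD : {morph chi : x y / x + y >-> x * y}.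
  by move=> x y; rewrite /chi -exprD zmod.
have chi0 : chi 0 = 1 by rewrite /chi expr0.
have norm_z : `|z| = 1.
  apply/eqP; rewrite -(pexpr_eq1 (prime_gt0 p_pr)) //.
  by rewrite -normrX zp normr1.
have norm_chi x : `|chi x| = 1 by rewrite /chi normrX norm_z expr1n.
have chiN x : chi (- x) = (chi x)^*.
  have nz : chi x != 0 by rewrite -normr_eq0 norm_chi oner_eq0.
  by apply: (mulfI nz); rewrite -chiD subrr chi0 -normCK norm_chi expr1n.
exists chi; split=> // x; case: eqP => [->|/eqP x0].
  under eq_bigr do rewrite mulr0 chi0.
  by rewrite sumr_const card_Fp.
have <- : \sum_a chi a = \sum_a chi (a * x).
  by rewrite [LHS](reindex_inj (mulIf x0)).
(* Translating the variable by 1 multiplies the sum by [chi 1] = z, which is not 1, so the sum is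
   zero. *)
have : chi 1 * (\sum_a chi a) = \sum_a chi a.
  rewrite mulr_sumr [RHS](reindex_inj (addrI 1)) /=.
  by apply: eq_bigr => a _; rewrite chiD.
move/eqP; rewrite -subr_eq0 -{2}[\sum_a _]mul1r -mulrBl mulf_eq0 subr_eq0.
case/orP => [|/eqP //]; rewrite /chi zmod expr1 => /eqP z1.
have := zP; rewrite z1 => /prim_order_dvd/(_ 1%N).
by rewrite expr1n eqxx dvdn1 => /eqP p1; rewrite p1 in p_pr.
Qed.

Section CharacterSums.
Variables (p : nat) (chi : 'F_p -> algC).
Hypothesis chiD : {morph chi : x y / x + y >-> x * y}.
Hypothesis chi0 : chi 0 = 1.
Hypothesis chi_sum : forall x, \sum_a chi (a * x) = if x == 0 then p%:R else 0.

Lemma char_sum I r (P : pred I) F :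
  chi (\sum_(i <- r | P i) F i) = \prod_(i <- r | P i) chi (F i).
Proof. exact: (big_morph chi chiD chi0). Qed.

(** Summing over all frequencies a detects the equation; for fixed a the sum over x factors over the
    coordinates. *)
Lemma fourier_count (k : nat) (e : 'I_k -> 'F_p) (T : finType) (P : pred T)
    (phi : T -> 'F_p) :
  p%:R * #|[set x : {ffun 'I_k -> T} | [forall i, P (x i)] &
            \sum_i e i * phi (x i) == 0]|%:R
  = \sum_a \prod_i \sum_(t | P t) chi (a * (e i * phi t)).
Proof.
under eq_bigr do rewrite bigA_distr_big_dep /=.
rewrite exchange_big /= mulr_natr -sumr_const.
under [RHS]eq_bigr => x _.
  under eq_bigr do rewrite -char_sum -mulr_sumr.
  rewrite chi_sum; over.
rewrite -big_mkcondr; apply: eq_bigl => x; rewrite inE; congr (_ && _).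
Qed.

(** Each label c carries its own equation, hence its own frequency. A label missed by [r] has an
    empty product and contributes just p. *)
Lemma fibre_count (k R : nat) (r : 'I_k -> 'I_R) (e : 'I_k -> 'F_p) (T : finType)
    (phi : T -> 'F_p) :
  p%:R ^+ R * #|[set x : {ffun 'I_k -> T} |
            [forall c, \sum_(i | r i == c) e i * phi (x i) == 0]]|%:R
  = \prod_c \sum_a \prod_(i | r i == c) \sum_t chi (a * (e i * phi t)) :> algC.
Proof.
transitivity (\sum_(x : {ffun 'I_k -> T})
    \prod_c \sum_a chi (a * \sum_(i | r i == c) e i * phi (x i))).
  rewrite mulr_natr -sumr_const big_mkcond; apply: eq_bigr => x _.
  rewrite inE; case: forallP => [h|h].
    under [RHS]eq_bigr do rewrite chi_sum h.
    by rewrite prodr_const card_ord.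
  have /existsP[c hc] : [exists c, \sum_(i | r i == c) e i * phi (x i) != 0].
    by rewrite -negb_forall; apply/forallP.
  by rewrite (bigD1 c) //= chi_sum (negPf hc) mul0r.
under [LHS]eq_bigr do rewrite bigA_distr_bigA /=.
rewrite exchange_big [RHS]bigA_distr_bigA; apply: eq_bigr => a _ /=.
transitivity (\prod_i \sum_t chi (a (r i) * (e i * phi t))).
  rewrite bigA_distr_bigA; apply: eq_bigr => x _.
  rewrite [RHS](partition_big r xpredT) //=; apply: eq_bigr => c _.
  by rewrite mulr_sumr char_sum; apply: eq_bigr => i /eqP->.
rewrite (partition_big r xpredT) //=; apply: eq_bigr => c _.
by apply: eq_bigr => i /eqP->.
Qed.
End CharacterSums.

(* Induction on k by Chebyshev's sum inequality: (x_i - x_j)(x_i^k - x_j^k) >= 0. *)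
Lemma power_mean (C : numDomainType) (I : finType) (x : I -> C) (k : nat) :
  (forall i, 0 <= x i) ->
  (\sum_i x i) ^+ k.+1 <= #|I|%:R ^+ k * \sum_i x i ^+ k.+1.
Proof.
move=> x0; elim: k => [|k IH].
  by rewrite expr1 mul1r; under [X in _ <= X]eq_bigr do rewrite expr1.
have s0 : 0 <= \sum_i x i by apply: sumr_ge0.
rewrite exprSr (le_trans (ler_wpM2r s0 IH)) // exprSr -!mulrA.
apply: ler_wpM2l; first by rewrite exprn_ge0 ?ler0n.
rewrite -subr_ge0 -(pmulrn_lge0 _ (isT : (0 < 2)%N)).
suff -> : (#|I|%:R * (\sum_i x i ^+ k.+2) - (\sum_i x i ^+ k.+1) * (\sum_i x i)) *+ 2
   = \sum_i \sum_j (x i - x j) * (x i ^+ k.+1 - x j ^+ k.+1).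
  apply: sumr_ge0 => i _; apply: sumr_ge0 => j _.
  rewrite subrXX mulrA -expr2 mulr_ge0 //.
    by rewrite real_exprn_even_ge0 // realB ?ger0_real.
  by apply: sumr_ge0 => m _; rewrite mulr_ge0 ?exprn_ge0.
have E i : \sum_j (x i - x j) * (x i ^+ k.+1 - x j ^+ k.+1) =
    #|I|%:R * x i ^+ k.+2 - x i * (\sum_j x j ^+ k.+1)
    - x i ^+ k.+1 * (\sum_j x j) + \sum_j x j ^+ k.+2.
  rewrite !mulr_sumr mulr_natl -sumr_const -!sumrB -big_split /=.
  by apply: eq_bigr => j _; rewrite !exprS; ring.
rewrite (eq_bigr _ (fun i _ => E i)) big_split /= sumr_const.
rewrite !sumrB -!mulr_suml -!mulr_sumr mulr2n -[X in _ = _ + X]mulr_natl; ring.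
Qed.

(* Moves the right-hand side of the congruence to the left: energy l below is J_l. *)
Definition half_sign (p l i : nat) : 'F_p :=
  if (i < l)%N then 1 else -1.

Definition energy (p l : nat) (T : finType) (P : pred T) (phi : T -> 'F_p) : nat :=
  #|[set x : {ffun 'I_(2 * l) -> T} | [forall i, P (x i)] &
       \sum_(i < 2 * l) half_sign p l i * phi (x i) == 0]|.

Lemma prod_half_sign (p l : nat) (C : comNzRingType) (F : 'F_p -> C) :
  \prod_(i < 2 * l) F (half_sign p l i) = (F 1 * F (- 1)) ^+ l.
Proof.
rewrite exprMn mul2n -addnn big_split_ord /=; congr (_ * _).
  by under eq_bigr => i _ do rewrite /half_sign /= ltn_ord; rewrite prodr_const card_ord.
under eq_bigr => i _ do rewrite /half_sign /= ltnNge leq_addr /=.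
by rewrite prodr_const card_ord.
Qed.

(** At each frequency the l positive signs give the exponential sum and the l negative signs its
    conjugate. *)
Lemma energy_moment (p l : nat) (chi : 'F_p -> algC) (T : finType) (P : pred T)
    (phi : T -> 'F_p) :
  {morph chi : x y / x + y >-> x * y} -> chi 0 = 1 -> (forall x, chi (- x) = (chi x)^*) ->
  (forall x, \sum_a chi (a * x) = if x == 0 then p%:R else 0) ->
  p%:R * (energy l P phi)%:R = \sum_a `|\sum_(t | P t) chi (a * phi t)| ^+ (2 * l).
Proof.
move=> chiD chi0 chiN chi_sum; rewrite (fourier_count chiD chi0 chi_sum).
apply: eq_bigr => a _.
rewrite (prod_half_sign _ (fun s => \sum_(t | P t) chi (a * (s * phi t)))).
rewrite exprM normCK rmorph_sum; congr ((_ * _) ^+ _).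
  by apply: eq_bigr => t _; rewrite mul1r.
by apply: eq_bigr => t _; rewrite mulN1r mulrN chiN.
Qed.

(** The exponential sum splits into one piece per cell of [b]; [power_mean] bounds its 2l-th power
    at each frequency, and [energy_moment] turns both sides back into counts. *)
Lemma energy_holder (p l : nat) (T B : finType) (b : T -> B) (phi : T -> 'F_p) :
  prime p -> (0 < l)%N ->
  (energy l xpredT phi <= #|B| ^ (2 * l).-1 * \sum_c energy l (fun t => b t == c) phi)%N.
Proof.
move=> p_pr l_gt0; have [chi [chi0 chiD chiN chi_sum]] := additive_character_exists p_pr.
have p0 : 0 < p%:R :> algC by rewrite ltr0n prime_gt0.
rewrite -(ler_nat algC) -(ler_pM2l p0) (energy_moment _ _ _ chiD chi0 chiN chi_sum).
rewrite natrM natrX natr_sum mulrCA mulr_sumr.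
under [X in _ <= _ * X]eq_bigr do rewrite (energy_moment _ _ _ chiD chi0 chiN chi_sum).
rewrite exchange_big mulr_sumr; apply: ler_sum => a _ /=.
rewrite (partition_big b xpredT) //=.
have k_gt0 : (0 < 2 * l)%N by rewrite muln_gt0.
rewrite -[in X in _ <= _ * X](prednK k_gt0) -{1}(prednK k_gt0).
apply: le_trans (power_mean _ _) => [|c]; last exact: normr_ge0.
by apply: lerXn2r; rewrite ?nnegrE ?sumr_ge0 ?normr_ge0 ?ler_norm_sum.
Qed.

(** * Configurations in which every signed sum vanishes *)

(** A map with s values factors through ['I_s]. The overcount is harmless: in the application |K| =
    2l, so s^|K| is bounded in terms of l. *)
Lemma card_ffun_image (K R : finType) (s : nat) :
  (#|[set r : {ffun K -> R} | #|[set r i | i : K]| == s]| <= #|R| ^ s * s ^ #|K|)%N.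
Proof.
pose f (wu : {ffun 'I_s -> R} * {ffun K -> 'I_s}) := [ffun i => wu.1 (wu.2 i)].
apply: leq_trans (_ : #|f @: [set: {ffun 'I_s -> R} * {ffun K -> 'I_s}]| <= _)%N; last first.
  by rewrite (leq_trans (leq_imset_card _ _)) // cardsT card_prod !card_ffun card_ord.
apply: subset_leq_card; apply/subsetP => r; rewrite inE => /eqP rs.
apply/imsetP; rewrite {}/f; move: s rs => _ <-.
have ri i : r i \in [set r i | i : K] by apply/imsetP; exists i.
exists ([ffun j => enum_val j], [ffun i => enum_rank_in (ri i) (r i)]) => //.
by apply/ffunP => i; rewrite !ffunE enum_rankK_in.
Qed.

(** With [r i] the offset of m_i in its block and [w (v i)] in the place of n_i!, this says that the
    polynomial P of [nonvanishing_shift_count] has all its coefficients zero. *)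
Definition vanishing (p l : nat) (V C : finType) (w : V -> 'F_p)
    (r : {ffun 'I_(2 * l) -> C}) (v : {ffun 'I_(2 * l) -> V}) : bool :=
  [forall c, \sum_(i < 2 * l | r i == c) half_sign p l i * w (v i) == 0].

Definition vanishing_number (p l : nat) (V : finType) (w : V -> 'F_p) (R : nat) : nat :=
  #|[set rv : {ffun 'I_(2 * l) -> 'I_R} * {ffun 'I_(2 * l) -> V} |
      vanishing w rv.1 rv.2]|.

(** A fibre with one index would leave a single term, plus or minus a nonzero weight. *)
Lemma vanishing_fibre_gt1 (p l : nat) (V C : finType) (w : V -> 'F_p) r
    (v : {ffun 'I_(2 * l) -> V}) (c : C) :
  (forall x, w x != 0) -> vanishing w r v -> c \in [set r i | i : 'I_(2 * l)] ->
  (1 < #|[pred i | r i == c]|)%N.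
Proof.
move=> w0 /forallP/(_ c) + /imsetP[i _ ci]; case: ltnP => // h.
rewrite (bigD1 i) ?ci //= big1 => [|j /andP[jc ij]].
  rewrite addr0 mulf_eq0 (negPf (w0 _)) orbF /half_sign.
  by case: ifP; rewrite ?oppr_eq0 oner_eq0.
move: h; rewrite (cardD1 i) (cardD1 j) !inE ci jc eqxx /=.
by rewrite eq_sym in ij; rewrite eq_sym ij.
Qed.

(** For each value taken, all but two of the exponential sums over its fibre are bounded trivially
    by |V|; the two left form a second moment, that is p J_1. The power of |V| on the left avoids
    subtracting exponents. *)
Lemma vanishing_count (p l R : nat) (V : finType) (w : V -> 'F_p)
    (r : {ffun 'I_(2 * l) -> 'I_R}) :
  prime p ->
  (forall c, c \in [set r i | i : 'I_(2 * l)] -> (1 < #|[pred i | r i == c]|)%N) ->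
  (#|V| ^ (2 * #|[set r i | i : 'I_(2 * l)]|) * #|[set v | vanishing w r v]|
    <= #|V| ^ (2 * l) * energy 1 xpredT w ^ #|[set r i | i : 'I_(2 * l)]|)%N.
Proof.
move=> p_pr fib.
have [chi [chi0 chiD chiN chi_sum]] := additive_character_exists p_pr.
have p0 : 0 < p%:R ^+ R :> algC by rewrite exprn_gt0 // ltr0n prime_gt0.
rewrite -(ler_nat algC) -(ler_pM2l p0) !natrM mulrCA.
rewrite (fibre_count chiD chi0 chi_sum).
set A := [set _ | _ in _].
pose S a := `|\sum_(t : V) chi (a * w t)|.
have chi1 x : `|chi x| = 1.
  by apply/eqP; rewrite -sqrp_eq1 // normCK -chiN -chiD subrr chi0.
have S0 a : 0 <= S a by exact: normr_ge0.
have SV a : S a <= #|V|%:R.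
  rewrite (le_trans (ler_norm_sum _ _ _)) //.
  by under eq_bigr do rewrite chi1; rewrite sumr_const.
have S_sign a (i : 'I_(2 * l)) : `|\sum_t chi (a * (half_sign p l i * w t))| = S a.
  rewrite /half_sign; case: ifP => _; first by under eq_bigr do rewrite mul1r.
  under eq_bigr do rewrite mulN1r mulrN chiN.
  by rewrite -rmorph_sum norm_conjC.
have Ec c : #|V|%:R ^+ (if c \in A then 2 else 0)
    * `|\sum_a \prod_(i | r i == c) \sum_t chi (a * (half_sign p l i * w t))|
   <= p%:R * (#|V|%:R ^+ #|[pred i | r i == c]|
              * (if c \in A then (energy 1 xpredT w)%:R else 1)).
  have le1 : `|\sum_a \prod_(i | r i == c) \sum_t chi (a * (half_sign p l i * w t))|
      <= \sum_a S a ^+ #|[pred i | r i == c]|.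
    apply: (le_trans (ler_norm_sum _ _ _)); apply: ler_sum => a _.
    by rewrite normr_prod; under eq_bigr do rewrite S_sign; rewrite prodr_const.
  case: ifP => cA; last first.
    rewrite mul1r mulr1 (le_trans le1) //.
    have -> : #|[pred i | r i == c]| = 0%N.
      apply/eq_card0 => i; rewrite !inE; apply: contraFF cA => /eqP <-.
      by apply/imsetP; exists i.
    by rewrite sumr_const card_Fp // expr0 mulr1 lexx.
  apply: le_trans (ler_wpM2l _ le1) _; first by rewrite exprn_ge0.
  rewrite mulrCA (energy_moment _ _ _ chiD chi0 chiN chi_sum) !mulr_sumr.
  apply: ler_sum => a _; have := fib _ cA.
  case: #|_| => [|[|k]] // _; rewrite -/(S a) -(addn2 k) muln1 !(exprD _ k 2).
  rewrite mulrCA -[leRHS]mulrA ler_wpM2r ?mulr_ge0 ?exprn_ge0 //.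
  by rewrite lerXn2r ?nnegrE.
have VA : \prod_c #|V|%:R ^+ (if c \in A then 2 else 0) = #|V|%:R ^+ (2 * #|A|) :> algC.
  rewrite exprM -prodr_const [RHS]big_mkcond; apply: eq_bigr => c _.
  by case: ifP.
have VR : \prod_c #|V|%:R ^+ #|[pred i | r i == c]| = #|V|%:R ^+ (2 * l) :> algC.
  rewrite prodrXr; congr (_ ^+ _).
  rewrite -[RHS]card_ord -sum1_card (partition_big r xpredT) //=.
  by apply: eq_bigr => c _; rewrite sum1_card.
have J1 : \prod_c (if c \in A then (energy 1 xpredT w)%:R else 1)
     = (energy 1 xpredT w)%:R ^+ #|A| :> algC.
  by rewrite -big_mkcond prodr_const.
rewrite !natrX -VR -J1 -VA.
have -> : p%:R ^+ R = \prod_(c < R) p%:R :> algC by rewrite prodr_const card_ord.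
have EW := fibre_count chiD chi0 chi_sum r (half_sign p l) w.
(* By [EW] the product is p^R times a count, hence nonnegative, so absolute values can be
   distributed over the labels. *)
rewrite -[X in _ * X <= _]ger0_norm; last by rewrite -EW mulr_ge0 // ltW.
rewrite normr_prod -!big_split /=; apply: ler_prod => c _.
by rewrite Ec mulr_ge0 ?exprn_ge0.
Qed.

(** Fibres of at least two indices leave at most l values. A single value imposes the full equation
    and gives J_l; [vanishing_count] serves for s >= 2. *)
Lemma vanishing_pairs_count (p l R : nat) (V : finType) (w : V -> 'F_p) :
  prime p -> (0 < l)%N -> (0 < #|V|)%N -> (forall x, w x != 0) ->
  (vanishing_number l w R
   <= R * energy l xpredT w
      + \sum_(2 <= s < l.+1)
          R ^ s * s ^ (2 * l) * (#|V| ^ (2 * (l - s)) * energy 1 xpredT w ^ s))%N.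
Proof.
move=> p_pr l_gt0 V_gt0 w0.
pose im (r : {ffun 'I_(2 * l) -> 'I_R}) := [set r i | i : 'I_(2 * l)].
pose W (r : {ffun 'I_(2 * l) -> 'I_R}) := #|[set v | vanishing w r v]|.
have -> : vanishing_number l w R = (\sum_r W r)%N.
  rewrite /vanishing_number -sum1_card; under eq_bigl do rewrite inE.
  rewrite -(pair_big_dep xpredT (fun r v => vanishing w r v) (fun _ _ => 1%N)) /=.
  by apply: eq_bigr => r _; rewrite sum1_card /W cardsE.
have k_gt0 : (0 < 2 * l)%N by rewrite muln_gt0.
pose i0 : 'I_(2 * l) := Ordinal k_gt0.
have im_gt0 r : (0 < #|im r|)%N.
  by apply/card_gt0P; exists (r i0); apply/imsetP; exists i0.
have W_le r : (W r <= if #|im r| == 1%N then energy l xpredT w else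
     if (#|im r| <= l)%N then #|V| ^ (2 * (l - #|im r|)) * energy 1 xpredT w ^ #|im r|
     else 0)%N.
  case: (posnP (W r)) => [-> //|/card_gt0P[v]]; rewrite inE => vr.
  have fib := fun c => vanishing_fibre_gt1 w0 vr (c := c).
  case: ifP => [/cards1P[c rc]|_].
    apply: subset_leq_card; apply/subsetP => u; rewrite !inE => /forallP/(_ c)/eqP uc.
    apply/andP; split; first exact/forallP.
    apply/eqP; rewrite -[RHS]uc [RHS]big_mkcond; apply: eq_bigr => i _.
    have : r i \in im r by apply/imsetP; exists i.
    by rewrite rc inE => ->.
  have im_le : (#|im r| <= l)%N.
    rewrite -(leq_pmul2l (isT : (0 < 2)%N)).
    rewrite -[X in (_ <= X)%N]card_ord -[X in (_ <= X)%N]sum1_card.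
    rewrite (partition_big r (mem (im r))) => [|i _]; last by apply/imsetP; exists i.
    rewrite mulnC -sum_nat_const; apply: leq_sum => c cr.
    by rewrite sum1_card; apply: fib.
  rewrite im_le -(leq_pmul2l (_ : 0 < #|V| ^ (2 * #|im r|))%N) ?expn_gt0 ?V_gt0 //.
  apply: leq_trans (vanishing_count w p_pr fib) _.
  by rewrite mulnA -expnD -mulnDr subnKC.
apply: (@leq_trans (\sum_(r : {ffun 'I_(2 * l) -> 'I_R}) _)).
  by apply: leq_sum => r _; exact: W_le.
rewrite (bigID (fun r => #|im r| == 1%N)) /=; apply: leq_add.
  rewrite (eq_bigr (fun=> energy l xpredT w)) => [|r ->] //.
  rewrite sum_nat_const leq_mul2r; apply/orP; right.
  have := card_ffun_image 'I_(2 * l) 'I_R 1; rewrite exp1n muln1 expn1 card_ord.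
  by rewrite cardsE.
rewrite (bigID (fun r => #|im r| <= l)%N) /= addnC big1 => [|r]; last first.
  by move=> /andP[/negPf -> /negPf ->].
rewrite add0n.
rewrite big_geq_mkord.
rewrite (partition_big (fun r => inord #|im r|) (fun s : 'I_l.+1 => 1 < s)%N) /=; last first.
  move=> r /andP[r1 rl]; rewrite inordK ?ltnS // ltn_neqAle eq_sym r1; exact: im_gt0.
apply: leq_sum => s s1.
rewrite (eq_bigr (fun=> #|V| ^ (2 * (l - s)) * energy 1 xpredT w ^ s)%N); last first.
  move=> r /andP[/andP[/negPf r1 rl] /eqP <-].
  by rewrite r1 rl inordK ?ltnS.
rewrite sum_nat_const leq_mul2r; apply/orP; right.
rewrite -[X in (X ^ s)%N]card_ord -[X in (s ^ X)%N]card_ord.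
apply: leq_trans (card_ffun_image _ _ _).
apply: subset_leq_card; apply/subsetP => r /andP[/andP[_ rl] /eqP <-].
by rewrite inE inordK ?ltnS.
Qed.

(** Only the partition of the indices into fibres matters, so the m_i may be replaced by offsets or
    residues. *)
Lemma vanishing_eq_fibres (p l : nat) (V C C' : finType) (w : V -> 'F_p)
    (r : {ffun 'I_(2 * l) -> C}) (r' : {ffun 'I_(2 * l) -> C'})
    (v : {ffun 'I_(2 * l) -> V}) :
  (forall i j, (r i == r j) = (r' i == r' j)) ->
  vanishing w r v -> vanishing w r' v.
Proof.
move=> rr' /forallP h; apply/forallP => c.
case: (pickP (fun i => r' i == c)) => [j /eqP <-|no].
  by under eq_bigl do rewrite -rr'; apply: h.
by rewrite big_pred0 // => i; rewrite no.
Qed.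

(** * Factorials modulo p as polynomial values *)

Lemma natr_Fp_inj (p m n : nat) :
  prime p -> (m < p)%N -> (n < p)%N -> m%:R = n%:R :> 'F_p -> m = n.
Proof.
move=> p_pr mp np /(congr1 val); rewrite /= !val_Fp_nat // !modn_small //.
Qed.

Lemma natr_fact_neq0 (p m : nat) : prime p -> (m < p)%N -> m`!%:R != 0 :> 'F_p.
Proof.
move=> p_pr; elim: m => [|m IH] mp; first by rewrite oner_eq0.
rewrite factS natrM mulf_neq0 ?IH ?(ltnW mp) //.
by rewrite -(dvdn_pcharf (pchar_Fp p_pr)) gtnNdvd.
Qed.

(* rising d is (X + 1)(X + 2)...(X + d), so that (m + d)! = m! * (rising d)(m). *)
Definition rising (F : comNzRingType) (d : nat) : {poly F} :=
  \prod_(t < d) ('X - (- t.+1%:R)%:P).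

Lemma natr_fact_rising (F : comNzRingType) (m d : nat) :
  (m + d)%N`!%:R = m`!%:R * (rising F d).[m%:R].
Proof.
rewrite /rising; elim: d => [|d IH]; first by rewrite addn0 big_ord0 hornerC mulr1.
rewrite big_ord_recr /= hornerM mulrA -IH addnS factS natrM mulrC; congr (_ * _).
by rewrite hornerXsubC opprK -natrD addnS.
Qed.

Lemma size_rising (F : comNzRingType) (d : nat) : size (rising F d) = d.+1.
Proof. by rewrite size_prod_XsubC /index_enum -enumT size_enum_ord. Qed.

(** These polynomials are monic of distinct degrees, so the largest index with a nonzero coefficient
    would show in the sum. *)
Lemma rising_free (F : comNzRingType) (R : nat) (a : 'I_R -> F) :
  \sum_c a c *: rising F c = 0 -> forall c, a c = 0.
Proof.
move=> s0 c; apply/eqP; apply: contraT => ac.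
pose m := [arg max_(i > c | a i != 0) i].
have [am hm] : a m != 0 /\ (forall i, a i != 0 -> (i <= m)%N).
  by rewrite /m; case: arg_maxnP => // i ai h; split.
have := congr1 (fun q : {poly F} => q`_m) s0; rewrite coef0 coef_sum (bigD1 m) //=.
rewrite big1 => [|i im].
  rewrite addr0 coefZ.
  have -> : (rising F m)`_m = 1.
    have /monicP : rising F m \is monic by apply: monic_prod_XsubC.
    by rewrite lead_coefE size_rising.
  by move/eqP; rewrite mulr1 (negPf am).
rewrite coefZ; have [->|ai] := eqVneq (a i) 0; first by rewrite mul0r.
rewrite nth_default ?mulr0 // size_rising.
by rewrite ltn_neqAle hm // andbT.
Qed.

Definition factorial_weight (p K M : nat) (m : 'I_M) : 'F_p := (K + 1 + m)%N`!%:R.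

(** [w] stays abstract: it is n! for the product congruence and the constant 1 when factorials alone
    are summed. *)
Definition factorial_phi (p K M : nat) (V : Type) (w : V -> 'F_p) (t : 'I_M * V) : 'F_p :=
  w t.2 * factorial_weight p K t.1.

(** Dividing by (K + 1 + m)! leaves P(K + 1 + m) = 0 with P of degree at most R'; these arguments
    are distinct mod p because K + M < p. *)
Lemma nonvanishing_shift_count (p l K M R' : nat) (V : finType) (w : V -> 'F_p)
    (d : {ffun 'I_(2 * l) -> 'I_R'.+1}) (v : {ffun 'I_(2 * l) -> V}) :
  prime p -> (K + M < p)%N -> ~~ vanishing w d v ->
  (#|[set m : 'I_M |
      (\sum_(i < 2 * l) half_sign p l i * (w (v i) * (K + 1 + m + d i)%N`!%:R) == 0)%R]|
   <= R')%N.
Proof.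
move=> p_pr KM nv.
set A := [set _ | _].
pose P : {poly 'F_p} := \sum_(i < 2 * l) (half_sign p l i * w (v i)) *: rising _ (d i).
(* The coefficient of [rising _ c] in P is the signed sum over the indices with offset c. *)
have P0 : P != 0.
  apply: contraNneq nv => P0; apply/forallP => c; apply/eqP.
  apply: (@rising_free _ R'.+1
    (fun c => \sum_(i < 2 * l | d i == c) half_sign p l i * w (v i))).
  rewrite -[RHS]P0 /P [RHS](partition_big d xpredT) //=; apply: eq_bigr => c2 _.
  by rewrite scaler_suml; apply: eq_bigr => i /eqP ->.
pose x (m : 'I_M) : 'F_p := (K + 1 + m)%N%:R.
have ltp (m : 'I_M) : (K + 1 + m < p)%N by have := ltn_ord m; lia.
have sP : (size P <= R'.+1)%N.
  rewrite (leq_trans (size_sum _ _ _)) //; apply/bigmax_leqP => i _.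
  by rewrite (leq_trans (size_scale_leq _ _)) // size_rising.
have := @max_poly_roots _ P [seq x m | m in A] P0.
rewrite size_map -cardE => h; rewrite -ltnS; apply: leq_trans sP; apply: h.
  apply/allP => _ /imageP[m mA ->]; rewrite /root.
  have f0 := natr_fact_neq0 p_pr (ltp m).
  apply/eqP/(mulfI f0); rewrite mulr0.
  move: mA; rewrite inE => /eqP sum0; rewrite -[RHS]sum0.
  rewrite /P horner_sum mulr_sumr; apply: eq_bigr => i _.
  by rewrite hornerZ (natr_fact_rising _ _ (d i)) mulrCA !mulrA.
rewrite map_inj_uniq ?enum_uniq // => m m' /(natr_Fp_inj p_pr (ltp _) (ltp _)) /addnI.
exact: val_inj.
Qed.

(** There are 2l choices for an index j of the least m_i, (R'+1)^(2l-1) for the offsets from it, the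
    one at j being zero, and |V|^(2l) for the v_i; the least value is then one of at most R'
    roots. *)
Lemma local_energy (p l K M R' : nat) (V : finType) (w : V -> 'F_p) :
  prime p -> (0 < l)%N -> (K + M < p)%N ->
  (#|[set x : {ffun 'I_(2 * l) -> 'I_M * V} |
       [&& [forall i, forall j, ((x i).1 < (x j).1 + R'.+1)%N],
           (\sum_(i < 2 * l) half_sign p l i * factorial_phi K w (x i) == 0)%R
         & ~~ vanishing w [ffun i => (x i).1] [ffun i => (x i).2]]]|
   <= 2 * l * (R' * (R'.+1 ^ (2 * l).-1 * #|V| ^ (2 * l))))%N.
Proof.
move=> p_pr l_gt0 KM; set S := [set _ | _].
have k_gt0 : (0 < 2 * l)%N by rewrite muln_gt0.
pose minimal (x : {ffun 'I_(2 * l) -> 'I_M * V}) j := [forall i, (x j).1 <= (x i).1]%N.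
apply: (@leq_trans (\sum_(j < 2 * l) #|[set x in S | minimal x j]|)%N).
  have -> : (\sum_(j < 2 * l) #|[set x in S | minimal x j]| =
      \sum_(x in S) \sum_(j < 2 * l | minimal x j) 1)%N.
    rewrite (exchange_big_dep xpredT) //=; apply: eq_bigr => j _.
    by rewrite -sum1_card; apply: eq_bigl => x; rewrite inE.
  rewrite -sum1_card; apply: leq_sum => x _.
  pose j := [arg min_(i < Ordinal k_gt0) (x i).1].
  have mj : minimal x j.
    by rewrite /j; case: arg_minnP => // i _ h; apply/forallP => i'; apply: h.
  by rewrite (bigD1 j).
rewrite -[X in (_ <= X * _)%N]card_ord -sum_nat_const; apply: leq_sum => j _.
pose f (x : {ffun 'I_(2 * l) -> 'I_M * V}) :
    {ffun 'I_(2 * l) -> 'I_R'.+1} * {ffun 'I_(2 * l) -> V} :=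
  ([ffun i => inord ((x i).1 - (x j).1)], [ffun i => (x i).2]).
have f_spec x i : x \in [set x in S | minimal x j] ->
    ((x i).1 = (x j).1 + (f x).1 i :> nat)%N.
  rewrite !inE => /andP[/and3P[/forallP/(_ i)/forallP/(_ j) h _ _] /forallP/(_ i) h'].
  by rewrite ffunE inordK ?subnKC // ltn_subLR.
pose D := [set dv : {ffun 'I_(2 * l) -> 'I_R'.+1} * {ffun 'I_(2 * l) -> V} |
  dv.1 j == ord0].
have cardD : #|D| = (R'.+1 ^ (2 * l).-1 * #|V| ^ (2 * l))%N.
  have -> : D = setX [set d in pffun_on ord0 (predC1 j) predT] setT.
    apply/setP => -[d v]; rewrite !inE andbT /=; apply/eqP/pffun_onP => [dj|[dj _]].
      split=> [|? _] //; apply/subsetP => i; rewrite !inE /=.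
      by apply: contra_neq => ->.
    apply/eqP; apply: contraT => h; have := subsetP dj j.
    by rewrite !inE eqxx => /(_ h).
  by rewrite cardsX cardsE card_pffun_on cardsT card_ffun cardC1 !card_ord.
rewrite -cardD -sum1_card.
rewrite (partition_big f (mem D)) => [|x xS]; last first.
  by rewrite !inE /f /= ffunE subnn; apply/eqP/val_inj; rewrite /= inordK.
rewrite [X in (_ <= X)%N]mulnC -sum_nat_const; apply: leq_sum => -[d v] _.
pose X := [set x | (x \in [set x in S | minimal x j]) && (f x == (d, v))].
rewrite (eq_bigl (mem X)) => [|x]; last by rewrite [RHS]inE.
have XP x : x \in X -> x \in [set x in S | minimal x j] /\ f x = (d, v).
  by rewrite /X in_set => /andP[xS /eqP].
rewrite sum1_card; have [->|/set0Pn[x0 /XP[x0S fx0]]] := eqVneq X set0.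
  by rewrite cards0.
have nv : ~~ vanishing w d v.
  have := x0S; rewrite !inE => /andP[/and3P[_ _ +] _]; apply: contra.
  have -> : [ffun i => (x0 i).2] = v by case: fx0.
  apply: vanishing_eq_fibres => i i'; rewrite ffunE ffunE.
  apply/eqP/eqP => [h|/(congr1 val) /= h].
    by apply: val_inj; rewrite /= (f_spec x0 i x0S) (f_spec x0 i' x0S) fx0 h.
  apply: val_inj; move: h; rewrite (f_spec x0 i x0S) (f_spec x0 i' x0S) fx0.
  exact: addnI.
(* On a fibre of [f] the tuple is determined by its least value. *)
rewrite -(card_in_image (f := fun x : {ffun 'I_(2 * l) -> 'I_M * V} => (x j).1)).
  apply: leq_trans (nonvanishing_shift_count p_pr KM nv).
  apply: subset_leq_card; apply/subsetP => _ /imageP[x /XP[xS fx] ->].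
  have := xS; rewrite !inE => /andP[/and3P[_ + _] _]; congr (_ == _).
  apply: eq_bigr => i _; rewrite /factorial_phi /factorial_weight (f_spec x i xS) fx addnA.
  by case: fx => _ <-; rewrite ffunE.
move=> x y /XP[xS fx] /XP[yS fy] exy.
apply/ffunP => i; apply/eqP; rewrite -pair_eqE; apply/andP; split.
  by apply/eqP/val_inj; rewrite /= (f_spec x i xS) (f_spec y i yS) fx fy exy.
by case: fx => _ /ffunP/(_ i); case: fy => _ <-; rewrite !ffunE => ->.
Qed.

(** * Reduction to blocks *)

(** After Hölder, the nonvanishing solutions of all blocks together fall under [local_energy], so
    they cost no further factor for the number of blocks; the vanishing ones are counted block by
    block. *)
Lemma block_energy (p l K M R' : nat) (V : finType) (w : V -> 'F_p) :
  prime p -> (0 < l)%N -> (K + M < p)%N ->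
  (energy l xpredT (factorial_phi (M := M) K w)
   <= (M %/ R'.+1).+1 ^ (2 * l).-1 *
      (2 * l * (R' * (R'.+1 ^ (2 * l).-1 * #|V| ^ (2 * l)))
       + (M %/ R'.+1).+1 *
         vanishing_number l w R'.+1))%N.
Proof.
move=> p_pr l_gt0 KM.
have k_gt0 : (0 < 2 * l)%N by rewrite muln_gt0.
pose b (t : 'I_M * V) : 'I_(M %/ R'.+1).+1 := inord (t.1 %/ R'.+1).
have bE t : (b t = t.1 %/ R'.+1 :> nat)%N.
  by rewrite /b inordK // ltnS leq_div2r // ltnW.
apply: leq_trans (energy_holder b _ p_pr l_gt0) _.
rewrite card_ord leq_mul2l; apply/orP; right.
pose van (x : {ffun 'I_(2 * l) -> 'I_M * V}) :=
  vanishing w [ffun i => (x i).1] [ffun i => (x i).2].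
pose inb (c : 'I_(M %/ R'.+1).+1) (x : {ffun 'I_(2 * l) -> 'I_M * V}) :=
  [forall i, b (x i) == c].
pose sol (x : {ffun 'I_(2 * l) -> 'I_M * V}) :=
  \sum_(i < 2 * l) half_sign p l i * factorial_phi K w (x i) == 0.
apply: (@leq_trans (\sum_c (#|[set x | [&& inb c x, sol x & ~~ van x]]|
                            + #|[set x | inb c x & van x]|))%N).
  apply: leq_sum => c _; rewrite /energy.
  apply: leq_trans (leq_card_setU _ _).
  apply: subset_leq_card; apply/subsetP => x; rewrite !inE => /andP[xc xs].
  by case: (boolP (van x)) => _; rewrite /inb xc ?orbT // /sol xs.
rewrite big_split /=; apply: leq_add.
  apply: leq_trans (local_energy R' w p_pr l_gt0 KM).
  rewrite -sum1_card.
  rewrite (partition_big (fun x : {ffun 'I_(2 * l) -> 'I_M * V} =>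
    b (x (Ordinal k_gt0))) xpredT) //=.
  apply: leq_sum => c _; rewrite sum1_card.
  apply: subset_leq_card; apply/subsetP => x; rewrite !inE => /and3P[/forallP xc xs xv].
  rewrite unfold_in /= inE xv andbT; apply/andP; split=> //; apply/andP; split=> //.
  apply/forallP => i; apply/forallP => j.
  have /(congr1 val) := etrans (eqP (xc i)) (esym (eqP (xc j))); rewrite /= !bE => h.
  rewrite (divn_eq (x i).1 R'.+1) (divn_eq (x j).1 R'.+1) h.
  by have := ltn_pmod (x i).1 (ltn0Sn R'); lia.
rewrite -[X in (_ <= X * _)%N]card_ord -sum_nat_const; apply: leq_sum => c _.
(* Within one block, residues modulo R' + 1 are offsets from its left end. *)
pose g (x : {ffun 'I_(2 * l) -> 'I_M * V}) :
    {ffun 'I_(2 * l) -> 'I_R'.+1} * {ffun 'I_(2 * l) -> V} :=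
  ([ffun i => inord ((x i).1 %% R'.+1)], [ffun i => (x i).2]).
have gE x i : ((g x).1 i = (x i).1 %% R'.+1 :> nat)%N.
  by rewrite ffunE inordK // ltn_pmod.
have inbE x i : inb c x -> ((x i).1 = c * R'.+1 + (g x).1 i :> nat)%N.
  by move=> /forallP/(_ i)/eqP <-; rewrite gE bE -divn_eq.
rewrite /vanishing_number -(card_in_imset (f := g)) => [|x y].
  apply: subset_leq_card; apply/subsetP => _ /imsetP[x + ->].
  rewrite !inE => /andP[xc]; apply: vanishing_eq_fibres => i j; rewrite ffunE ffunE.
  apply/eqP/eqP => [h|/(congr1 val) /= h].
    by apply: val_inj; rewrite /= !gE h.
  by apply: val_inj; rewrite /= (inbE x i xc) (inbE x j xc) h.
rewrite !inE => /andP[xc _] /andP[yc _] gxy.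
apply/ffunP => i; apply/eqP; rewrite -pair_eqE; apply/andP; split.
  by apply/eqP/val_inj; rewrite /= (inbE x i xc) (inbE y i yc) gxy.
by case: gxy => _ /ffunP/(_ i); rewrite !ffunE => ->.
Qed.

(** * Choice of the block length *)

Lemma energy_le_inj (p l : nat) (T T' : finType) (f : T -> T')
    (phi : T -> 'F_p) (phi' : T' -> 'F_p) :
  injective f -> (forall t, phi' (f t) = phi t) ->
  (energy l xpredT phi <= energy l xpredT phi')%N.
Proof.
move=> f_inj phiE.
pose g (x : {ffun 'I_(2 * l) -> T}) := [ffun i => f (x i)].
have g_inj : injective g.
  by move=> x y /ffunP xy; apply/ffunP => i; have := xy i; rewrite !ffunE => /f_inj.
rewrite /energy -(card_imset _ g_inj).
apply: subset_leq_card; apply/subsetP => _ /imsetP[x + ->].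
rewrite !inE => /andP[_ sol]; apply/andP; split; first exact/forallP.
by under eq_bigr do rewrite ffunE phiE.
Qed.

(** Here x is the real block length and c Z bounds the vanishing pairs per unit of length. The last
    hypothesis keeps the vanishing term below the polynomial one. *)
Lemma energy_of_vanishing (R : realType) (p l K M R' : nat) (V : finType)
    (w : V -> 'F_p) (x Z c : R) :
  prime p -> (0 < l)%N -> (0 < M)%N -> (K + M < p)%N ->
  0 < x -> x <= M%:R -> R'%:R <= x -> x <= R'.+1%:R -> 0 <= c -> 0 <= Z ->
  (vanishing_number l w R'.+1)%:R <= c * (R'.+1%:R * Z) ->
  M%:R * Z <= x ^+ (2 * l) * #|V|%:R ^+ (2 * l) ->
  (energy l xpredT (factorial_phi (M := M) K w))%:R
    <= 3 ^+ (2 * l) * ((2 * l)%:R + c) * (M%:R ^+ (2 * l).-1 * #|V|%:R ^+ (2 * l) * x).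
Proof.
move=> p_pr l_gt0 M_gt0 KM x0 xM R'x xR c0 Z0.
have := block_energy R' w p_pr l_gt0 KM.
set D := vanishing_number _ _ _; set E := energy _ _ _; set B := (_ %/ _).+1.
have [k' kE] : exists k', (2 * l = k'.+1)%N.
  by exists (2 * l)%N.-1; rewrite prednK // muln_gt0.
rewrite !kE succnK -(ler_nat R) natrM natrX natrD.
rewrite [(k'.+1 * _)%:R]natrM !(natrM _ R') !(natrM _ (_ ^ _)) !(natrM _ B) !natrX.
move=> Eb Db MZ.
have M0 : 0 < M%:R :> R by rewrite ltr0n.
have B0 : 0 <= B%:R :> R by [].
(* B (R' + 1) <= M + R' + 1 <= 2M + 1 <= 3M. *)
have BR : B%:R * R'.+1%:R <= 3 * M%:R :> R.
  have RM : (R' <= M)%N by rewrite -(ler_nat R) (le_trans R'x).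
  rewrite -natrM -[3]/(3%:R) -natrM ler_nat /B mulSn.
  by have := leq_trunc_div M R'.+1; move: RM M_gt0; clear; lia.
have Bx : B%:R * x <= 3 * M%:R by apply: le_trans BR; rewrite ler_wpM2l.
have Bx0 : 0 <= B%:R * x by rewrite mulr_ge0 // ltW.
apply: (le_trans Eb); rewrite mulrDr mulrDr mulrDl lerD //.
  rewrite (_ : B%:R ^+ k' * _ =
    k'.+1%:R * ((B%:R * R'.+1%:R) ^+ k' * #|V|%:R ^+ k'.+1 * R'%:R)); last first.
    by rewrite exprMn; ring.
  rewrite [leRHS](_ : _ =
    k'.+1%:R * (3 ^+ k'.+1 * M%:R ^+ k' * #|V|%:R ^+ k'.+1 * x)); last by ring.
  rewrite ler_wpM2l //; apply: ler_pM => //.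
    by rewrite mulr_ge0 ?exprn_ge0 ?mulr_ge0.
  rewrite ler_wpM2r ?exprn_ge0 //.
  apply: le_trans (_ : (3 * M%:R) ^+ k' <= _).
    by rewrite lerXn2r ?nnegrE ?mulr_ge0.
  by rewrite exprMn ler_wpM2r ?exprn_ge0 // ler_weXn2l // ler1n.
(* Multiplying by x^(2l-1) replaces a division: each B x is then at most 3M. *)
rewrite -(ler_pM2r (exprn_gt0 k' x0)).
apply: le_trans (_ : B%:R ^+ k' * (B%:R * (c * (R'.+1%:R * Z))) * x ^+ k' <= _).
  by rewrite ler_wpM2r ?(exprn_ge0 _ (ltW x0)) // !ler_wpM2l ?exprn_ge0.
rewrite (_ : B%:R ^+ k' * _ * _ =
  c * ((B%:R * x) ^+ k' * (B%:R * R'.+1%:R) * Z)); last first.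
  by rewrite exprMn; ring.
rewrite [leRHS](_ : _ =
  c * (3 ^+ k'.+1 * M%:R ^+ k' * (x ^+ k'.+1 * #|V|%:R ^+ k'.+1))); last first.
  by rewrite [x ^+ _.+1]exprS; ring.
rewrite ler_wpM2l //.
apply: le_trans (_ : (3 * M%:R) ^+ k' * (3 * M%:R) * Z <= _).
  rewrite ler_wpM2r //; apply: ler_pM; rewrite ?exprn_ge0 ?mulr_ge0 ?(ltW x0) //.
  by rewrite lerXn2r ?nnegrE ?Bx0 ?mulr_ge0.
rewrite (_ : _ * Z = 3 ^+ k'.+1 * M%:R ^+ k' * (M%:R * Z)); last first.
  by rewrite exprMn exprS; ring.
by rewrite ler_wpM2l ?mulr_ge0 ?exprn_ge0.
Qed.

(** [unit] stands for the absent n_i: its energies are at most 1, so a block of length Q has O(Q^l)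
    vanishing pairs. With Z = x^(l-1) the balance N Z = x^(2l) becomes x^(l+1) = N. *)
Lemma factorial_energy (R : realType) (l : nat) : (0 < l)%N ->
  exists2 C : R, 0 <= C & forall (p L N : nat) (x : R),
    prime p -> (0 < N)%N -> (L + N < p)%N -> 0 <= x -> x ^+ l.+1 = N%:R ->
    (energy l xpredT (@factorial_weight p L N))%:R
      <= C * (N%:R ^+ (2 * l).-1 * x).
Proof.
move=> l_gt0; pose c : R := (1 + l * l ^ (2 * l))%:R * 2 ^+ l.
exists (3 ^+ (2 * l) * ((2 * l)%:R + c)).
  by rewrite mulr_ge0 ?exprn_ge0 // addr_ge0 // mulr_ge0 // exprn_ge0.
move=> p L N x p_pr N_gt0 LN x_ge0 xN.
have x1 : 1 <= x.
  by rewrite -(expr_ge1 (n := l.+1)) // xN ler1n.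
have x0 : 0 < x by apply: lt_le_trans x1.
have xleN : x <= N%:R by rewrite -xN -[leLHS]expr1 ler_weXn2l.
pose w (_ : unit) : 'F_p := 1.
have unit_energy k : (energy k xpredT w <= 1)%N.
  by rewrite (leq_trans (max_card _)) // card_ffun card_unit exp1n.
have := @energy_of_vanishing R p l L N (Num.truncn x) unit w x (x ^+ l.-1) c
  p_pr l_gt0 N_gt0 LN x0 xleN.
rewrite card_unit expr1n !mulr1 => H.
apply: le_trans (H _ _ _ _ _ _).
- rewrite ler_nat; apply: (@energy_le_inj _ _ _ _ (fun n => (n, tt))) => [m n [] //|n].
  by rewrite /factorial_phi mul1r.
- by rewrite truncn_le.
- by rewrite ltW // truncnS_gt.
- by rewrite mulr_ge0 // exprn_ge0.
- by rewrite exprn_ge0.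
- set Q := (Num.truncn x).+1.
  have Qx : Q%:R <= 2 * x.
    rewrite /Q -natr1; have : (Num.truncn x)%:R <= x by rewrite truncn_le.
    lra.
  apply: le_trans (_ : ((1 + l * l ^ (2 * l)) * Q ^ l)%:R <= _).
    rewrite ler_nat; apply: leq_trans (vanishing_pairs_count _ p_pr l_gt0 _ _) _.
    + by rewrite card_unit.
    + by move=> ?; exact: oner_neq0.
    rewrite mulnDl mul1n leq_add //.
      rewrite (leq_trans (leq_mul (leqnn Q) (unit_energy l))) // muln1.
      by rewrite -[X in (X <= _)%N]expn1 leq_pexp2l.
    apply: (@leq_trans (\sum_(2 <= s < l.+1) l ^ (2 * l) * Q ^ l)%N).
      rewrite !big_nat; apply: leq_sum => s /andP[s2 sl]; rewrite ltnS in sl.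
      have J1 : (energy 1 xpredT w ^ s <= 1)%N.
        by rewrite -[X in (_ <= X)%N](exp1n s) leq_exp2r // ltnW.
      rewrite card_unit exp1n mul1n -[X in (_ <= X)%N]muln1 [X in (_ <= X * _)%N]mulnC.
      by rewrite leq_mul // leq_mul ?leq_pexp2l // leq_exp2r // muln_gt0.
    by rewrite sum_nat_const_nat mulnA !leq_mul2r subSS leq_subr !orbT.
  rewrite natrM natrX /c -!mulrA ler_wpM2l // -(prednK l_gt0) /=.
  have -> : 2 ^+ l.-1.+1 * (Q%:R * x ^+ l.-1) = 2 * ((2 * x) ^+ l.-1 * Q%:R).
    by rewrite exprMn exprS; ring.
  rewrite exprSr -[leLHS]mul1r; apply: ler_pM; rewrite ?mulr_ge0 ?exprn_ge0 ?ler1n //.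
  by rewrite ler_wpM2r // lerXn2r ?nnegrE // mulr_ge0.
- by rewrite -xN -exprD addSnnS prednK // addnn -mul2n lexx.
Qed.

Ltac nonneg :=
  repeat first [done | exact: ler0n | exact: ltW
               | apply: exprn_ge0 | apply: addr_ge0 | apply: mulr_ge0].

(** This is the term with s values in [vanishing_pairs_count], up to s^(2l), with t = N^(1/2) and J
    = J_1. One factor Q is kept, the others are at most 2y, and what remains is (y/t)^(s-2) <= 1. *)
Lemma fibre_term_le (R : realType) (l s : nat) (J Q y t C N : R) :
  (2 <= s)%N -> (s <= l)%N -> 0 <= J -> J <= C * t ^+ 3 -> 1 <= C ->
  0 <= Q -> Q <= 2 * y -> 0 <= y -> y <= t -> t ^+ 2 = N ->
  Q ^+ s * (N ^+ (2 * (l - s)) * J ^+ s) <= 2 ^+ l * C ^+ l * (Q * (N ^+ (2 * l).-1 * y)).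
Proof.
move=> s2 sl J0 JC C1 Q0 Qy y0 yt tN.
have t0 : 0 <= t by apply: le_trans yt.
have C0 : 0 <= C by apply: le_trans C1.
case: s s2 sl => [|[|u]] // _ ul.
move: (subnK ul); move: (l - u.+2)%N => e <-.
rewrite -tN.
apply: le_trans (_ : (Q * (2 * y) ^+ u.+1) *
    ((t ^+ 2) ^+ (2 * e) * (C * t ^+ 3) ^+ u.+2) <= _).
  have ? : 0 <= C * t ^+ 3 by nonneg.
  apply: ler_pM; [by nonneg | by nonneg | |].
    by rewrite exprS ler_wpM2l // lerXn2r ?nnegrE // mulr_ge0.
  by rewrite ler_wpM2l ?exprn_ge0 // lerXn2r ?nnegrE.
have -> : (2 * (e + u.+2)).-1 = (2 * e + 2 * u + 3)%N by lia.
have -> : Q * (2 * y) ^+ u.+1 * ((t ^+ 2) ^+ (2 * e) * (C * t ^+ 3) ^+ u.+2) =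
   (2 ^+ u.+1 * C ^+ u.+2) * (Q * y) * (y ^+ u * (t ^+ (2 * (2 * e) + 3 * u.+2))).
  rewrite -exprM [(C * _) ^+ _]exprMn -exprM [(2 * y) ^+ _]exprMn exprD [y ^+ u.+1]exprS.
  by ring.
have -> : 2 ^+ (e + u.+2) * C ^+ (e + u.+2) *
      (Q * ((t ^+ 2) ^+ (2 * e + 2 * u + 3) * y)) =
   (2 ^+ (e + u.+2) * C ^+ (e + u.+2)) * (Q * y) *
      (t ^+ u * t ^+ (2 * (2 * e) + 3 * u.+2)).
  rewrite -exprD -exprM.
  rewrite (_ : (2 * (2 * e + 2 * u + 3) = u + (2 * (2 * e) + 3 * u.+2))%N); last by lia.
  by ring.
apply: ler_pM; [by nonneg | by nonneg | |].
  rewrite ler_wpM2r ?mulr_ge0 //; apply: ler_pM; [by nonneg | by nonneg | |].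
    by rewrite ler_weXn2l ?ler1n //; lia.
  by rewrite ler_weXn2l //; lia.
by rewrite ler_wpM2r ?exprn_ge0 // lerXn2r ?nnegrE.
Qed.

(* Here t = N^(1/2), y = N^(1/(l+1)) and x = M^(1/(2l)) N^(-1/(2(l+1))). The block *)
(* length is floor(x) + 1, so that x < 1 gives blocks of length 1, on which the *)
(* polynomial argument leaves no error term at all.                             *)
Lemma product_energy (R : realType) (l : nat) : (0 < l)%N ->
  exists2 C : R, 0 <= C & forall (p K L M N : nat) (x y t : R),
    prime p -> (0 < M)%N -> (K + M < p)%N -> (0 < N)%N -> (L + N < p)%N ->
    (M <= N ^ 2)%N ->
    0 < x -> x <= M%:R -> 0 <= y -> 0 <= t ->
    t ^+ 2 = N%:R -> y ^+ l.+1 = N%:R -> x ^+ (2 * l) * y ^+ l = M%:R ->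
    (energy l xpredT (factorial_phi (M := M) K (@factorial_weight p L N)))%:R
      <= C * (M%:R ^+ (2 * l).-1 * N%:R ^+ (2 * l) * x).
Proof.
move=> l_gt0.
have [C1 C1_ge0 J1le] := factorial_energy R (isT : (0 < 1)%N).
have [C2 C2_ge0 Jlle] := factorial_energy R l_gt0.
(* C2 comes from s = 1, the rest from the l - 1 values s >= 2, with s^(2l) <= l^(2l). Since 1 + C1
   >= 1, its s-th power is at most its l-th. *)
pose c : R := C2 + (l * l ^ (2 * l))%:R * (2 ^+ l * (1 + C1) ^+ l).
have c_ge0 : 0 <= c by rewrite addr_ge0 // !mulr_ge0 // exprn_ge0 // addr_ge0.
exists (3 ^+ (2 * l) * ((2 * l)%:R + c)).
  by rewrite mulr_ge0 ?exprn_ge0 // addr_ge0.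
move=> p K L M N x y t p_pr M_gt0 KM N_gt0 LN MN x_gt0 xM y_ge0 t_ge0 tN yN xyM.
set w := @factorial_weight p L N.
have y1 : 1 <= y.
  by rewrite -(expr_ge1 (n := l.+1)) // yN ler1n.
have y_gt0 : 0 < y by apply: lt_le_trans y1.
have w_neq0 n : w n != 0.
  by apply: natr_fact_neq0 p_pr _; have := ltn_ord n; lia.
have N_ge0 : 0 <= N%:R :> R by [].
set Q := (Num.truncn x).+1.
have Qx : Q%:R <= x + 1.
  by rewrite /Q -natr1 lerD2r truncn_le ltW.
have := @energy_of_vanishing R p l K M (Num.truncn x) _ w x (N%:R ^+ (2 * l).-1 * y) c
  p_pr l_gt0 M_gt0 KM x_gt0 xM.
rewrite card_ord; apply.
- by rewrite truncn_le ltW.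
- by rewrite ltW // truncnS_gt.
- exact: c_ge0.
- by rewrite mulr_ge0 // exprn_ge0.
- rewrite -/Q; apply: le_trans (_ : (Q * energy l xpredT w + \sum_(2 <= s < l.+1)
      Q ^ s * s ^ (2 * l) * (N ^ (2 * (l - s)) * energy 1 xpredT w ^ s))%:R <= _).
    rewrite ler_nat; have := @vanishing_pairs_count p l Q _ w p_pr l_gt0.
    by rewrite card_ord; apply.
  rewrite natrD natrM /c mulrDl lerD //.
    rewrite mulrCA ler_wpM2l //.
    exact: Jlle.
  rewrite natr_sum.
  apply: le_trans (_ : \sum_(2 <= s < l.+1) (l ^ (2 * l))%:R *
      (2 ^+ l * (1 + C1) ^+ l * (Q%:R * (N%:R ^+ (2 * l).-1 * y))) <= _).
    rewrite !big_nat; apply: ler_sum => s /andP[s2 sl]; rewrite ltnS in sl.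
    have l2 := leq_trans s2 sl.
    rewrite [(Q ^ s * _)%N]mulnC -mulnA natrM; apply: ler_pM => //.
      by rewrite ler_nat leq_exp2r // muln_gt0.
    rewrite !natrM !natrX; apply: (@fibre_term_le R l s _ _ y t (1 + C1)) => //.
    + rewrite (le_trans (J1le _ _ _ _ p_pr N_gt0 LN t_ge0 tN)) // expr1 -tN -exprSr.
      by rewrite ler_wpM2r ?exprn_ge0 // lerDr.
    + by rewrite lerDl.
    (* Q <= x + 1 <= 2y as y >= 1. For x <= y: x^(2l) y^l = M <= N^2 = y^(2l+2) <= y^(3l), since l
       >= s >= 2. *)
    + suff : x <= y by lra.
      rewrite -(ler_pXn2r (n := 2 * l)) ?muln_gt0 ?nnegrE ?(ltW x_gt0) //.
      rewrite -(ler_pM2r (exprn_gt0 l y_gt0)) xyM -exprD.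
      apply: le_trans (_ : (N ^ 2)%:R <= _); first by rewrite ler_nat.
      by rewrite natrX -yN -exprM ler_weXn2l //; move: l2; clear; lia.
    + rewrite -(ler_pXn2r (n := 2)) ?nnegrE // tN -yN ler_weXn2l //; lia.
  rewrite sumr_const_nat -[leLHS]mulr_natl mulrA -natrM -[leRHS]mulrA; apply: ler_wpM2r.
    by nonneg.
  by rewrite ler_nat leq_mul2r subSS leq_subr orbT.
(* The balance with Z = N^(2l-1) y: the factor y^l of M completes y^(l+1) = N. *)
have -> : M%:R * (N%:R ^+ (2 * l).-1 * y) =
    x ^+ (2 * l) * (N%:R ^+ (2 * l).-1 * y ^+ l.+1).
  by rewrite -xyM exprSr; ring.
by rewrite yN -exprSr prednK // muln_gt0.
Qed.

(** * From the congruence to the energy, and the real exponents *)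

Lemma F_count_le_energy (p l K M L N : nat) :
  prime p -> (0 < M)%N -> (0 < N)%N ->
  (F_count p l K M L N <=
     energy l xpredT (factorial_phi (M := M) K (@factorial_weight p L N)))%N.
Proof.
move=> p_pr M_gt0 N_gt0.
pose g (x : {ffun 'I_(2 * l) -> 'I_M * 'I_N}) :
    {ffun 'I_(2 * l) -> 'I_(K + M).+1} * {ffun 'I_(2 * l) -> 'I_(L + N).+1} :=
  ([ffun i => inord (K + 1 + (x i).1)], [ffun i => inord (L + 1 + (x i).2)]).
apply: leq_trans (leq_imset_card g _); apply: subset_leq_card; apply/subsetP => -[m n].
rewrite inE /= => /and3P[/forallP Km /forallP Ln /eqP eq_mod].
(* The defaults of [insubd] are never reached, as K + 1 <= m_i <= K + M and L + 1 <= n_i <= L +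
   N. *)
pose x : {ffun 'I_(2 * l) -> 'I_M * 'I_N} :=
  [ffun i => (insubd (Ordinal M_gt0) (m i - (K + 1))%N,
              insubd (Ordinal N_gt0) (n i - (L + 1))%N)].
have x1 i : (K + 1 + (x i).1 = m i)%N.
  have := Km i; have := ltn_ord (m i).
  by rewrite ffunE val_insubd /=; case: ifP; lia.
have x2 i : (L + 1 + (x i).2 = n i)%N.
  have := Ln i; have := ltn_ord (n i).
  by rewrite ffunE val_insubd /=; case: ifP; lia.
apply/imsetP; exists x; last first.
  by rewrite /g; congr (_, _); apply/ffunP => i; rewrite ffunE ?x1 ?x2 inord_val.
rewrite inE; apply/andP; split; first exact/forallP.
pose a (i : 'I_(2 * l)) := ((n i)`! * (m i)`!)%N.
have -> : \sum_(i < 2 * l) half_sign p l i * factorial_phi K (@factorial_weight p L N) (x i)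
    = (\sum_(i < 2 * l | (i < l)%N) a i)%N%:R
      - (\sum_(i < 2 * l | (l <= i)%N) a i)%N%:R :> 'F_p.
  rewrite (bigID (fun i : 'I_(2 * l) => (i < l)%N)) /= !natr_sum -sumrN; congr (_ + _).
    apply: eq_bigr => i il; rewrite /half_sign il mul1r.
    by rewrite /factorial_phi /factorial_weight x1 x2 natrM.
  apply: eq_big => [i|i il]; first by rewrite -leqNgt.
  by rewrite /half_sign (negPf il) mulN1r /factorial_phi /factorial_weight x1 x2 natrM.
by rewrite -(Fp_nat_mod p_pr) eq_mod (Fp_nat_mod p_pr) subrr.
Qed.

Theorem theorem3 (R : realType) (l : nat) (hl : (1 <= l)%N) :
  exists c : R, 0 < c /\
    forall p K L M N : nat,
      prime p -> odd p ->
      (0 <= K < K + M)%N -> (K + M < p)%N ->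
      (0 <= L < L + N)%N -> (L + N < p)%N ->
      (M <= N ^ 2)%N -> N%:R `^ (1 / 2) <= M%:R :> R ->
      (F_count p l K M L N)%:R <=
        c * (M%:R `^ ((2 * l)%:R - 1 + 1 / (2 * l)%:R)
             * N%:R `^ ((2 * l)%:R - 1 / (2 * (l + 1))%:R)).
Proof.
have [C C0 HC] := product_energy R hl.
(* The added 1 makes the constant strictly positive. *)
exists (C + 1); split=> [|p K L M N p_pr _ /andP[_ KM] KMp /andP[_ LN] LNp MN _].
  by rewrite ltr_wpDl.
have M_gt0 : (0 < M)%N by rewrite -(ltn_add2l K) addn0.
have N_gt0 : (0 < N)%N by rewrite -(ltn_add2l L) addn0.
have M0 : 0 < M%:R :> R by rewrite ltr0n.
have N0 : 0 < N%:R :> R by rewrite ltr0n.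
have M1 : 1 <= M%:R :> R by rewrite ler1n.
have N1 : 1 <= N%:R :> R by rewrite ler1n.
have k0 : (2 * l)%:R != 0 :> R by rewrite pnatr_eq0 muln_eq0 /= -lt0n.
have l10 : (l%:R + 1 : R) != 0 by rewrite natr1 pnatr_eq0.
have powX (b r : R) n : (b `^ r) ^+ n = b `^ (r * n%:R).
  by rewrite -powR_mulrn ?powR_ge0 // powRrM.
have powD (b r s : R) : 0 < b -> b `^ r * b `^ s = b `^ (r + s).
  by move=> b0; rewrite powRD // (gt_eqF b0) implybT.
(* This solves x^(2l) y^l = M for y = N^(1/(l+1)). *)
pose x := M%:R `^ (1 / (2 * l)%:R) * N%:R `^ (- (1 / (2 * (l + 1))%:R)) : R.
have x0 : 0 < x by rewrite mulr_gt0 ?powR_gt0.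
have xM : x <= M%:R.
  rewrite -[leRHS]mulr1; apply: ler_pM; rewrite ?powR_ge0 //.
    rewrite -[leRHS]powRr1 ?(ltW M0) // ler_powR // ler_pdivrMr ?mul1r.
      by rewrite ler1n muln_gt0.
    by rewrite ltr0n muln_gt0.
  rewrite -[leRHS](powRr0 N%:R) ler_powR // oppr_le0 divr_ge0 //.
apply: le_trans (_ : (energy l xpredT (factorial_phi (M := M) K
    (@factorial_weight p L N)))%:R <= _).
  by rewrite ler_nat F_count_le_energy.
apply: le_trans (HC p K L M N x (N%:R `^ (1 / (l + 1)%:R)) (N%:R `^ (1 / 2))
  _ _ _ _ _ _ _ _ _ _ _ _ _) _;
  rewrite ?powR_ge0 //.
- by rewrite powX -[RHS]powRr1 ?(ltW N0) //; congr (_ `^ _); field.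
- rewrite powX -[RHS]powRr1 ?(ltW N0) //; congr (_ `^ _).
  by rewrite addn1 div1r mulVf // pnatr_eq0.
- rewrite exprMn !powX -mulrA powD //.
  rewrite div1r mulVf // powRr1 ?(ltW M0) //.
  rewrite (_ : _ + _ = 0) ?powRr0 ?mulr1 //.
  by rewrite !natrM natrD; field.
apply: ler_pM => //; rewrite ?lerDl //; first by nonneg.
(* The factor x supplies the fractional parts 1/(2l) and -1/(2(l+1)) of the two exponents. *)
rewrite -!powR_mulrn ?(ltW M0) ?(ltW N0) // mulrACA !powD //.
rewrite (_ : (2 * l).-1%:R = (2 * l)%:R - 1) ?lexx //.
by rewrite -[in RHS](prednK (_ : 0 < 2 * l)%N) ?muln_gt0 // -natr1 addrK.
Qed.
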